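(* Let $\mathcal M$ be a convex class of probability distributions on an observation domain $\mathsf O$, and let $T'\colon\mathcal M\to2^{\mathsf A}$ with $T'(F)\neq\emptyset$ for all $F\in\mathcal M$ satisfy the selective CxLS* property. Suppose there are distributions $F,G,H\in\mathcal M$ such that $$T'(F)\cap T'(G)=\{t_1\},\qquad T'(F)\cap T'(H)=\{t_2\},\qquad\text{with } t_1\ne t_2.$$ Then any specification $T\colon\mathcal M\to\mathsf A$ of $T'$ is neither elicitable nor identifiable. Moreover, if $\mathsf A$ is a topological space with a Fréchet topology, that is, if for any $a,b\in\mathsf A$ with $a\ne b$ there is an open set $U\subseteq\mathsf A$ such that $a\in U$ and $b\notin U$, then any specification $T$ of $T'$ fails to be mixture-continuous.
   Context: A specification of $T'$ is a point-valued map $T\colon\mathcal M\to\mathsf A$ with $T(F)\in T'(F)$ for all $F\in\mathcal M$. Selective CxLS* property: for all $F_0,F_1\in\mathcal M$ and $\lambda\in(0,1)$ with $(1-\lambda)F_0+\lambda F_1\in\mathcal M$: if $T'(F_0)\cap T'(F_1)\neq\emptyset$ then $T'(F_0)\cap T'(F_1)=T'((1-\lambda)F_0+\lambda F_1)$. For $S\colon\mathsf A\times\mathsf O\to(-\infty,\infty]$ put $\bar S(x,F)=\int S(x,y)\,dF(y)$, assumed to exist in $(-\infty,\infty]$, and assumed $\mathcal M$-finite: $\bar S(x,F)<\infty$ for all $x\in\mathsf A$, $F\in\mathcal M$. $S$ is strictly $\mathcal M$-consistent for $T$ if $\bar S(T(F),F)\le\bar S(x,F)$ for all $x\in\mathsf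 A$, $F\in\mathcal M$, with equality only if $x=T(F)$. $T$ is elicitable if such an $S$ exists. $T$ is identifiable if there is a strict $\mathcal M$-identification function, i.e. a map $V\colon\mathsf A\times\mathsf O\to\mathbb R^k$ (some $k$) whose expectations $\bar V(x,F)=\int V(x,y)\,dF(y)$ exist and are finite, with $\bar V(x,F)=0$ iff $x=T(F)$, for all $x\in\mathsf A$, $F\in\mathcal M$. A functional $T$ from a convex class $\mathcal M$ to a topological space $\mathsf A$ is mixture-continuous if for any $F_0,F_1\in\mathcal M$ the map $[0,1]\ni\lambda\mapsto T((1-\lambda)F_0+\lambda F_1)\in\mathsf A$ is continuous. *)

(* Defs.v *)
From HB Require Import structures.
From mathcomp Require Import all_boot all_order all_algebra.
From mathcomp Require Import all_classical all_reals all_analysis.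
From mathcomp Require Import measurable_realfun.

Set Implicit Arguments.
Unset Strict Implicit.
Unset Printing Implicit Defensive.

Import Order.TTheory GRing.Theory Num.Theory numFieldNormedType.Exports.
Local Open Scope classical_set_scope.
Local Open Scope ring_scope.

(* Only weights [l] in [0, 1] are meaningful ([mixtureE]); the truncation makes
   [mixture l F0 F1] a probability measure for every real [l], so that
   [l |-> mixture l F0 F1] is a total function on [R]. *)
Definition clamp01 (R : realType) (l : R) : R := Num.max 0 (Num.min l 1).

Lemma clamp01_id (R : realType) (l : R) : 0 <= l <= 1 -> clamp01 l = l.
Proof. by case/andP=> l0 l1; rewrite /clamp01 min_l// max_r. Qed.

Lemma clamp01_ge0 (R : realType) (l : R) : 0 <= clamp01 l.
Proof. by rewrite /clamp01 le_max lexx. Qed.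

Lemma onem_clamp01_ge0 (R : realType) (l : R) : 0 <= 1 - clamp01 l.
Proof. by rewrite subr_ge0 /clamp01 ge_max ler01 ge_min lexx orbT. Qed.

Section mixture.
Context d (O : measurableType d) (R : realType).
Variables (l : R) (F0 F1 : probability O R).

Definition mixture_fun : set O -> \bar R :=
  measure_add (mscale (NngNum (onem_clamp01_ge0 l)) F0)
              (mscale (NngNum (clamp01_ge0 l)) F1).

HB.instance Definition _ := Measure.on mixture_fun.

Let mixture_funE (A : set O) :
  mixture_fun A = ((1 - clamp01 l)%:E * F0 A + (clamp01 l)%:E * F1 A)%E.
Proof. by rewrite /mixture_fun measure_addE. Qed.

Let mixture_setT : mixture_fun setT = 1%E.
Proof. by rewrite mixture_funE !probability_setT !mule1 -EFinD subrK. Qed.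

HB.instance Definition _ :=
  Measure_isProbability.Build d O R mixture_fun mixture_setT.

Definition mixture : probability O R := mixture_fun.

Lemma mixtureE (A : set O) : 0 <= l <= 1 ->
  mixture A = ((1 - l)%:E * F0 A + l%:E * F1 A)%E.
Proof. by move=> l01; have := mixture_funE A; rewrite clamp01_id. Qed.

End mixture.

Section functionals.
Context d (O : measurableType d) (R : realType).
Implicit Types (M : set (probability O R)) (F : probability O R).

Definition convex_class M : Prop :=
  forall F0 F1 (l : R), M F0 -> M F1 -> 0 <= l <= 1 -> M (mixture l F0 F1).

Definition selective_CxLS_star (A : Type) M
    (T' : probability O R -> set A) : Prop :=
  forall F0 F1 (l : R), M F0 -> M F1 -> 0 < l < 1 -> M (mixture l F0 F1) ->
    T' F0 `&` T' F1 !=set0 -> T' F0 `&` T' F1 = T' (mixture l F0 F1).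

Definition specification (A : Type) M (T' : probability O R -> set A)
    (T : probability O R -> A) : Prop :=
  forall F, M F -> T' F (T F).

Definition expected_score (A : Type) (S : A -> O -> \bar R) (x : A) F : \bar R :=
  (\int[F]_y S x y)%E.

(* [S] takes values in (-oo, +oo]. Finiteness of the integral of the negative
   part says that the expected score exists in (-oo, +oo]; the library integral
   is total, so this has to be required explicitly. *)
Definition finite_score (A : Type) M (S : A -> O -> \bar R) : Prop :=
  (forall x y, (-oo < S x y)%E) /\
  (forall x F, M F ->
    [/\ measurable_fun setT (S x),
        (\int[F]_y (S x)^\- y < +oo)%E &
        (expected_score S x F < +oo)%E]).

Definition strictly_consistent (A : Type) M (S : A -> O -> \bar R)
    (T : probability O R -> A) : Prop :=
  forall x F, M F ->
    (expected_score S (T F) F <= expected_score S x F)%E /\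
    (expected_score S (T F) F = expected_score S x F -> x = T F).

Definition elicitable (A : Type) M (T : probability O R -> A) : Prop :=
  exists S : A -> O -> \bar R, finite_score M S /\ strictly_consistent M S T.

Definition expected_ident (A : Type) (k : nat) (V : A -> O -> 'rV[R]_k)
    (x : A) F : 'rV[R]_k :=
  \row_i Rintegral F setT (fun y => V x y 0 i).

Definition strict_identification (A : Type) M (T : probability O R -> A)
    (k : nat) (V : A -> O -> 'rV[R]_k) : Prop :=
  forall x F, M F ->
    (forall i, F.-integrable setT (fun y => (V x y 0 i)%:E)) /\
    (expected_ident V x F = 0 <-> x = T F).

Definition identifiable (A : Type) M (T : probability O R -> A) : Prop :=
  exists (k : nat) (V : A -> O -> 'rV[R]_k), strict_identification M T V.

Definition mixture_continuous (A : topologicalType) M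
    (T : probability O R -> A) : Prop :=
  forall F0 F1, M F0 -> M F1 ->
    {within `[0, 1], continuous (fun l : R => T (mixture l F0 F1))}.

End functionals.

(* Main.v *)
(* Selectivity forces T = t1 on the open segment between F and G and T = t2 on
   the one between F and H.  Elicitability, identifiability and mixture-continuity
   each propagate such a constant value t to the endpoint F, so that
   t1 = T F = t2.  For a score, consistency on the segment compares two affine
   functions of the weight, and letting the weight tend to 0 shows that t
   minimises the expected score under F; for an identification function, an
   affine function vanishing on (0, 1) vanishes at 0; for continuity, the T1 axiom
   separates T F from t. *)
Require Import Defs.
From mathcomp Require Import all_boot all_order all_algebra.
From mathcomp Require Import all_classical all_reals all_analysis.
From mathcomp Require Import measurable_realfun ring lra.

Set Implicit Arguments.
Unset Strict Implicit.
Unset Printing Implicit Defensive.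

Import Order.TTheory GRing.Theory Num.Theory numFieldNormedType.Exports.
Local Open Scope classical_set_scope.
Local Open Scope ring_scope.

Section probability_ext.
Context d (O : measurableType d) (R : realType).

(* All fields of the structures bundled in [probability] are propositions, so
   proof irrelevance identifies two probabilities with the same set function. *)
Lemma probability_ext (P Q : probability O R) :
  (P : set O -> \bar R) = Q -> P = Q.
Proof.
destruct P as [p [[p1 p2] [p3] [p4] [p5] [p6] [p7] [p8]]].
destruct Q as [q [[q1 q2] [q3] [q4] [q5] [q6] [q7] [q8]]] => /= pq.
subst q.
have e1 := Prop_irrelevance p1 q1; have e2 := Prop_irrelevance p2 q2.
subst q1 q2.
rewrite (Prop_irrelevance p3 q3) (Prop_irrelevance p4 q4).
rewrite (Prop_irrelevance p5 q5) (Prop_irrelevance p6 q6).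
by rewrite (Prop_irrelevance p7 q7) (Prop_irrelevance p8 q8).
Qed.

(** Mixture-continuity speaks about [T] at the mixture of weight 0; this is what turns that value
    into [T F]. *)
Lemma mixture0 (F0 F1 : probability O R) : mixture 0 F0 F1 = F0.
Proof.
apply/probability_ext/funext => A.
by rewrite mixtureE ?lexx ?ler01// subr0 mul1e mul0e adde0.
Qed.

End probability_ext.

Section integral_mixture.
Context d (O : measurableType d) (R : realType).
Local Open Scope ereal_scope.

Lemma ge0_integral_mixture (F0 F1 : probability O R) (l : R) (f : O -> \bar R) :
    (0 <= l <= 1)%R -> measurable_fun setT f -> (forall y, 0 <= f y) ->
  \int[mixture l F0 F1]_y f y =
  (1 - l)%:E * \int[F0]_y f y + l%:E * \int[F1]_y f y.
Proof.
move=> l01 mf f0.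
(* By construction the mixture is a sum of two scaled measures; in this form the integral is
   additive and homogeneous in the measure. *)
rewrite (eq_measure_integral (measure_add
  (mscale (NngNum (onem_clamp01_ge0 l)) F0)
  (mscale (NngNum (clamp01_ge0 l)) F1))) //.
rewrite ge0_integral_measure_add// !ge0_integral_mscale//=.
by rewrite clamp01_id.
Qed.

Lemma integral_mixture (F0 F1 : probability O R) (l : R) (f : O -> \bar R) :
    (0 <= l <= 1)%R ->
    F0.-integrable setT f -> F1.-integrable setT f ->
  \int[mixture l F0 F1]_y f y =
  (1 - l)%:E * \int[F0]_y f y + l%:E * \int[F1]_y f y.
Proof.
move=> l01 if0 if1; have mf := measurable_int F0 if0.
rewrite integralE [\int[F0]_y _]integralE [\int[F1]_y _]integralE.
rewrite !ge0_integral_mixture//;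
  [|exact: measurable_funeneg|exact: measurable_funepos].
have p0 := integrable_pos_fin_num measurableT if0.
have n0 := integrable_neg_fin_num measurableT if0.
have p1 := integrable_pos_fin_num measurableT if1.
have n1 := integrable_neg_fin_num measurableT if1.
(* All four integrals of positive and negative parts are finite, so the identity descends to [R],
   where regrouping cannot meet an undefined difference. *)
rewrite -(fineK p0) -(fineK n0) -(fineK p1) -(fineK n1).
by rewrite -!(EFinM, EFinB, EFinD); congr EFin; ring.
Qed.

(** Once the integral of [f^\-] is finite, it can be moved across the bound on the integral of [f],
    which bounds the integral of [f^\+] too. Thus every score in [finite_score] is integrable. *)
Lemma integrable_funeneg_lty (F : probability O R) (f : O -> \bar R) :
    measurable_fun setT f ->
    \int[F]_y f^\- y < +oo -> \int[F]_y f y < +oo -> F.-integrable setT f.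
Proof.
move=> mf fn fi; apply/integrableP; split=> //.
rewrite -/(abse \o f) fune_abse ge0_integralD//;
  [|exact: measurable_funepos|exact: measurable_funeneg].
rewrite lte_add_pinfty//.
have nfin : \int[F]_y f^\- y \is a fin_num.
  by rewrite ge0_fin_numE// integral_ge0.
by move: fi; rewrite [X in X < _ -> _]integralE lteBlDr// addye//
  gt_eqF// ltNye_eq nfin.
Qed.

End integral_mixture.

Lemma le_of_convex_comb_le (R : realFieldType) (a a' b b' : R) :
    (forall l, 0 < l < 1 -> (1 - l) * a + l * b <= (1 - l) * a' + l * b') ->
  a <= a'.
Proof.
move=> h; rewrite leNgt; apply/negP => aa'.
pose D := a - a'; pose E := `|b' - b|.
have D0 : 0 < D by rewrite subr_gt0.
have E0 : 0 <= E by exact: normr_ge0.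
have bE : b' - b <= E by exact: ler_norm.
have DE0 : 0 < 2 * (D + E) by lra.
(* The hypothesis gives [(1 - l) * D <= l * E], that is [D <= l * (D + E)]; this [l] makes the right
   side [D / 2]. *)
pose l := D / (2 * (D + E)).
have l0 : 0 < l by rewrite divr_gt0.
have lE : l * (2 * (D + E)) = D by rewrite divfK// gt_eqF.
have l1 : l < 1 by rewrite ltr_pdivrMr//; lra.
have := h l; rewrite l0 l1 => /(_ isT).
have : l * (b' - b) <= l * E by rewrite ler_pM2l.
rewrite /D in D0 lE *.
nra.
Qed.

Section constant_segment.
Context d (O : measurableType d) (R : realType) (A : Type).
Variables (M : set (probability O R)) (F G : probability O R).
Variables (T : probability O R -> A) (t : A).
Hypotheses (MF : M F) (MG : M G).
Hypothesis MFG : forall l : R, 0 < l < 1 -> M (mixture l F G).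
Hypothesis TFG : forall l : R, 0 < l < 1 -> T (mixture l F G) = t.

Lemma elicitable_segment : elicitable M T -> T F = t.
Proof.
move=> [S [[_ fS] cS]].
have iS x P : M P -> P.-integrable setT (S x).
  by move=> /(fS x)[mS nS pS]; exact: integrable_funeneg_lty.
have fin x P (MP : M P) := integrable_fin_num measurableT (iS x P MP).
have [leF eqF] := cS t F MF.
apply/esym/eqF; apply/le_anti/andP; split=> //.
rewrite /expected_score -(fineK (fin t F MF)) -(fineK (fin (T F) F MF)).
rewrite lee_fin; apply: le_of_convex_comb_le => l l01.
have l01' : 0 <= l <= 1 by case/andP: l01 => /ltW -> /ltW ->.
(* On the segment [t] is the optimal report, and the competitor to test it against is [T F]. *)
have [] := cS (T F) _ (MFG l01).
rewrite TFG// /expected_score !integral_mixture//; try exact: iS.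
rewrite -(fineK (fin t F MF)) -(fineK (fin (T F) F MF)).
rewrite -(fineK (fin t G MG)) -(fineK (fin (T F) G MG)).
by rewrite -!(EFinM, EFinD) lee_fin => + _; exact.
Qed.

Lemma identifiable_segment : identifiable M T -> T F = t.
Proof.
move=> [k [V idV]]; have [iF _] := idV t F MF; have [iG _] := idV t G MG.
apply/esym/(idV t F MF).2/rowP => i; rewrite !mxE /Rintegral.
have fF := integrable_fin_num measurableT (iF i).
have fG := integrable_fin_num measurableT (iG i).
have combE l : 0 < l < 1 ->
    (1 - l) * fine (\int[F]_y (V t y 0 i)%:E) +
    l * fine (\int[G]_y (V t y 0 i)%:E) = 0.
  move=> l01; have [_ [_ /(_ (esym (TFG l01)))]] := idV t _ (MFG l01).
  move=> /rowP/(_ i); rewrite !mxE /Rintegral integral_mixture//; last first.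
    by case/andP: l01 => /ltW -> /ltW ->.
  by rewrite -(fineK fF) -(fineK fG) -!(EFinM, EFinD).
(* Two distinct weights already force both coefficients to vanish. *)
have h2 := combE 2^-1; have h3 := combE 3^-1.
lra.
Qed.

End constant_segment.

Lemma mixture_continuous_segment d (O : measurableType d) (R : realType)
    (A : topologicalType) (M : set (probability O R)) (F G : probability O R)
    (T : probability O R -> A) (t : A) :
    accessible_space A -> M F -> M G ->
    (forall l : R, 0 < l < 1 -> T (mixture l F G) = t) ->
  mixture_continuous M T -> T F = t.
Proof.
move=> T1 MF MG TFG /(_ F G MF MG)/subspace_continuousP/(_ 0).
rewrite /= in_itv/= lexx ler01 => /(_ isT); rewrite /from_subspace.
rewrite mixture0 => cT.
apply: contrapT => /eqP/T1[U [oU /set_mem FU /set_mem tU]].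
have /cT : nbhs (T F) U by exact: open_nbhs_nbhs.
rewrite /nbhs/= => -[e /= e0 eU].
(* A weight within [e] of 0 that still lies in the open segment, where [T] takes the value [t]
   excluded from [U]. *)
pose l : R := Num.min (e / 2) 2^-1.
have l0 : 0 < l by rewrite lt_min; apply/andP; split; lra.
have le : l < e by rewrite gt_min; apply/orP; left; lra.
have l1 : l < 1 by rewrite gt_min; apply/orP; right; lra.
apply: tU; rewrite /= -(TFG l) ?l0//; apply: (eU l) => /=.
  by rewrite sub0r normrN gtr0_norm.
by rewrite in_itv/= !ltW.
Qed.

(** The intersection contains [t], so selectivity applies and makes [T'] the singleton of [t] along
    the open segment, leaving a specification no choice. *)
Lemma CxLS_star_segment d (O : measurableType d) (R : realType) (A : Type)
    (M : set (probability O R)) (T' : probability O R -> set A)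
    (F G : probability O R) (T : probability O R -> A) (t : A) :
    convex_class M -> selective_CxLS_star M T' -> specification M T' T ->
    M F -> M G -> T' F `&` T' G = [set t] ->
  forall l : R, 0 < l < 1 -> T (mixture l F G) = t.
Proof.
move=> Mc T'C sT MF MG FG l l01.
have MFG : M (mixture l F G).
  by apply: Mc => //; case/andP: l01 => /ltW -> /ltW ->.
have := sT _ MFG; rewrite -(T'C F G) ?FG//.
by exists t.
Qed.

Theorem proposition3p12 (R : realType) (d : measure_display)
    (O : measurableType d) (A : Type) (M : set (probability O R))
    (T' : probability O R -> set A)
    (M_convex : convex_class M)
    (T'_neq0 : forall F, M F -> T' F !=set0)
    (T'_CxLS : selective_CxLS_star M T')
    (F G H : probability O R) (MF : M F) (MG : M G) (MH : M H)
    (t1 t2 : A)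
    (FG : T' F `&` T' G = [set t1])
    (FH : T' F `&` T' H = [set t2])
    (t12 : t1 <> t2) :
  (forall T : probability O R -> A, specification M T' T ->
     ~ elicitable M T /\ ~ identifiable M T) /\
  (* [topA] is an arbitrary topology (topological structure) on the set [A];
     [accessible_space] is the Frechet (T1) separation axiom. *)
  (forall topA : Topological.axioms_ A,
     let AT : topologicalType := Topological.Pack topA in
     accessible_space AT ->
     forall T : probability O R -> AT, specification M T' T ->
       ~ mixture_continuous M T).
Proof.
have convM P Q (l : R) : M P -> M Q -> 0 < l < 1 -> M (mixture l P Q).
  by move=> MP MQ /andP[l0 l1]; apply: M_convex => //; rewrite !ltW.
split=> [T sT|topA AT T1 T sT cT].
  have TFG := CxLS_star_segment M_convex T'_CxLS sT MF MG FG.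
  have TFH := CxLS_star_segment M_convex T'_CxLS sT MF MH FH.
  split=> hT; apply: t12.
    rewrite -(elicitable_segment MF MG _ TFG hT); last by move=> l; exact: convM.
    by apply: (elicitable_segment MF MH _ TFH hT) => l; exact: convM.
  rewrite -(identifiable_segment MF MG _ TFG hT); last by move=> l; exact: convM.
  by apply: (identifiable_segment MF MH _ TFH hT) => l; exact: convM.
apply: t12.
have TFG := CxLS_star_segment M_convex T'_CxLS sT MF MG FG.
have TFH := CxLS_star_segment M_convex T'_CxLS sT MF MH FH.
rewrite -(mixture_continuous_segment T1 MF MG TFG cT).
exact: (mixture_continuous_segment T1 MF MH TFH cT).
Qed.
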